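(* Let $s_1,\dots,s_m$ be a sequence of $m$ non-negative integers and $M=m+\sum_{i=1}^{m}s_i$. The searchable partial sum with inserts (SPSI) data structure implemented in the \texttt{DYNAMIC} library, maintaining $s_1,\dots,s_m$, takes at most $$2\cdot m\left(\log(M/m)+\log\log m+\mathcal{O}(\log M/\log m)\right)$$ bits of space and supports the operations \texttt{sum}, \texttt{search}, \texttt{update}, and \texttt{insert} on the sequence $s_1,\dots,s_m$ in $\mathcal{O}(\log m)$ time.
   Context: Logarithms are base 2. The SPSI problem asks to maintain a sequence $s_1,\dots,s_m$ of non-negative integers supporting: $\texttt{sum}(i)=\sum_{j=1}^{i}s_j$; $\texttt{search}(x)$ = the smallest $i$ with $\sum_{j=1}^{i}s_j>x$; $\texttt{update}(i,\delta)$: replace $s_i$ by $s_i+\delta$ (with $\delta$ possibly negative provided $s_i+\delta\ge 0$); $\texttt{insert}(i)$: insert a $0$ between $s_{i-1}$ and $s_i$ (at the front if $i=0$). The \texttt{DYNAMIC} SPSI structure is a B-tree with constant node fanout $f\in\mathcal{O}(1)$ storing the integers $s_1,\dots,s_m$ in order in its leaves; every leaf stores a number $l$ of integers with $0.5\log m\le l\le\log m$. Inside each leaf the integers are packed contiguously in a word array, each integer using a number of bits equal to $\lfloor\log_2 x\rfloor+1$ for $x$ the largest integer stored in that leaf; space is allocated only for the integers actually stored in the leaf (the leaf is reallocated on insertion, split, or when an update makes an integer exceed the leaf's bit-width). Each internal node and leaf stores $\mathcal{O}(1)$ pointers/counters (subtree sizes and partial sums) of $\mathcal{O}(\log M)$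 bits each; operations traverse the tree from the root to a leaf using these counters. *)

(* Defs.v *)
(* MathComp and MathComp-Analysis. *)
From HB Require Import structures.
From mathcomp Require Import all_boot all_order all_algebra.
From mathcomp Require Import reals exp.

Set Implicit Arguments.
Unset Strict Implicit.
Unset Printing Implicit Defensive.

Definition log2 (R : realType) (x : R) : R := (ln x / ln 2)%R.

(* Time.  A timed computation is a value paired with the number of steps spent
   on it; a step stands for a bounded number of word-RAM instructions: following
   a pointer, reading, comparing or writing the counters of one child, reading
   or writing one packed integer, allocating one block. *)
Definition timed (A : Type) : Type := (A * nat)%type.

Definition ret (A : Type) (a : A) : timed A := (a, 0).

Definition charge (A : Type) (n : nat) (c : timed A) : timed A :=
  (c.1, n + c.2).

Definition bind (A B : Type) (c : timed A) (k : A -> timed B) : timed B :=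
  charge c.2 (k c.1).

Notation value c := (fst c) (only parsing).
Notation time c := (snd c) (only parsing).

Notation "x <-- c ;; d" := (bind c (fun x => d))
  (at level 100, c at level 99, d at level 200, right associativity).

(* Shape.  [Leaf b xs] is the packed array of the integers xs, each in a field
   of b bits.  [Node es] lists, for each child from left to right, the number
   of integers below it, their sum, and (the pointer to) the child. *)
Inductive tree : Type :=
| Leaf of nat & seq nat
| Node of seq (nat * nat * tree).

Definition entry : Type := (nat * nat * tree)%type.

(* The whole structure: its length m, its total sum and its root. *)
Definition spsi : Type := entry.

Fixpoint flat (t : tree) : seq nat :=
  match t with
  | Leaf _ xs => xs
  | Node es => flatten [seq flat e.2 | e <- es]
  end.

Definition contents (D : spsi) : seq nat := flat D.2.

Fixpoint leaves (t : tree) : seq (seq nat) :=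
  match t with
  | Leaf _ xs => [:: xs]
  | Node es => flatten [seq leaves e.2 | e <- es]
  end.

(* floor(log2 x) + 1 for the largest x in xs; since trunc_log 2 0 = 0, an
   all-zero leaf uses one bit per integer. *)
Definition width (xs : seq nat) : nat := (trunc_log 2 (\max_(x <- xs) x)).+1.

(* Space in bits on a machine with w-bit words.  A leaf has three header words
   (pointer to the array, number of integers, field width) and an array made of
   a whole number of words.  An internal node has a child count and room for f
   children, with a pointer and two counters each. *)
Definition array_bits (w n : nat) : nat := w * ((n + w.-1) %/ w).

Fixpoint tree_bits (f w : nat) (t : tree) : nat :=
  match t with
  | Leaf b xs => 3 * w + array_bits w (size xs * b)
  | Node es => (3 * f + 1) * w + sumn [seq tree_bits f w e.2 | e <- es]
  end.

Definition spsi_bits (f w : nat) (D : spsi) : nat := 3 * w + tree_bits f w D.2.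

(* All leaves at depth h; between lo and f children at the root of t and between
   ceil(f/2) and f children at the other internal nodes; exact counters and
   field widths. *)
Fixpoint btree (f lo h : nat) (t : tree) {struct t} : bool :=
  match t, h with
  | Leaf b xs, 0 => b == width xs
  | Node es, h'.+1 =>
      (lo <= size es <= f) &&
      all (fun e => [&& e.1.1 == size (flat e.2), e.1.2 == sumn (flat e.2)
                      & btree f (uphalf f) h' e.2]) es
  | _, _ => false
  end.

(* A structure with the stated leaf occupancy 0.5 log m <= l <= log m, where
   log m is rounded down: without rounding no structure exists for m = 5, 7. *)
Definition spsi_wf (f : nat) (D : spsi) : Prop :=
  let m := size (contents D) in
  [/\ 2 <= m, D.1 = (m, sumn (contents D)),
      (exists h, btree f 2 h D.2)
    & all (fun xs => trunc_log 2 m <= 2 * size xs <= 2 * trunc_log 2 m)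
          (leaves D.2)].

Definition spsi_empty : spsi := (0, 0, Leaf (width [::]) [::]).

Definition addz (n : nat) (d : int) : nat := `|(n%:Z + d)%R|%N.

Fixpoint leaf_sum (xs : seq nat) (i acc : nat) : timed nat :=
  match xs, i with
  | x :: xs', i'.+1 => charge 1 (leaf_sum xs' i' (acc + x))
  | _, _ => charge 1 (ret acc)
  end.

Fixpoint tree_sum (t : tree) (i acc : nat) {struct t} : timed nat :=
  charge 1
  match t with
  | Leaf _ xs => leaf_sum xs i acc
  | Node es =>
      (fix go (es : seq entry) (i acc : nat) : timed nat :=
         match es with
         | [::] => ret acc
         | (n, s, c) :: es' =>
             charge 1 (if i <= n then tree_sum c i acc
                       else go es' (i - n) (acc + s))
         end) es i acc
  end.

Definition spsi_sum (D : spsi) (i : nat) : timed nat := tree_sum D.2 i 0.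

(* j counts the integers already skipped. *)
Fixpoint leaf_search (xs : seq nat) (x j : nat) : timed nat :=
  match xs with
  | [::] => charge 1 (ret j)
  | y :: xs' =>
      charge 1 (if x < y then ret j.+1 else leaf_search xs' (x - y) j.+1)
  end.

Fixpoint tree_search (t : tree) (x j : nat) {struct t} : timed nat :=
  charge 1
  match t with
  | Leaf _ xs => leaf_search xs x j
  | Node es =>
      (fix go (es : seq entry) (x j : nat) : timed nat :=
         match es with
         | [::] => ret j
         | (n, s, c) :: es' =>
             charge 1 (if x < s then tree_search c x j
                       else go es' (x - s) (j + n))
         end) es x j
  end.

Definition spsi_search (D : spsi) (x : nat) : timed nat := tree_search D.2 x 0.

(* One integer is rewritten, the leaf is scanned for its maximum, and it is
   reallocated and repacked when the required field width has changed.  The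
   positions i of the leaf_ and tree_ procedures below are counted from 0. *)
Definition leaf_update (b : nat) (xs : seq nat) (i : nat) (d : int)
    : timed tree :=
  let xs' := set_nth 0 xs i (addz (nth 0 xs i) d) in
  charge (1 + size xs')
    (if width xs' == b then ret (Leaf b xs')
     else charge (1 + size xs') (ret (Leaf (width xs') xs'))).

Fixpoint tree_update (t : tree) (i : nat) (d : int) {struct t} : timed tree :=
  charge 1
  match t with
  | Leaf b xs => leaf_update b xs i d
  | Node es =>
      (es1 <--
         (fix go (es : seq entry) (i : nat) : timed (seq entry) :=
            match es with
            | [::] => ret [::]
            | (n, s, c) :: es' =>
                charge 1
                  (if i < n
                   then (c1 <-- tree_update c i d ;;
                         ret ((n, addz s d, c1) :: es'))
                   else (es1 <-- go es' (i - n) ;; ret ((n, s, c) :: es1)))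
            end) es i ;;
       ret (Node es1))
  end.

Definition spsi_update (D : spsi) (i : nat) (d : int) : timed spsi :=
  let: (m, s, t) := D in
  (t1 <-- tree_update t i.-1 d ;; charge 1 (ret (m, addz s d, t1))).

(* Allocating a leaf takes three passes over its integers: their sum, their
   maximum, and the packing. *)
Definition new_leaf (xs : seq nat) : timed entry :=
  charge (1 + 3 * size xs) (ret (size xs, sumn xs, Leaf (width xs) xs)).

Definition new_node (es : seq entry) : timed entry :=
  charge (1 + size es)
    (ret (sumn [seq e.1.1 | e <- es], sumn [seq e.1.2 | e <- es], Node es)).

(* Insertion returns the entries that replace the one of the visited subtree:
   two of them if its root was split.  A leaf is split when it exceeds cap
   integers and an internal node when it exceeds f children. *)
Definition leaf_insert (cap : nat) (xs : seq nat) (i : nat)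
    : timed (seq entry) :=
  let xs' := take i xs ++ 0 :: drop i xs in
  charge (size xs')
    (if size xs' <= cap then (e <-- new_leaf xs' ;; ret [:: e])
     else (e1 <-- new_leaf (take (size xs')./2 xs') ;;
           e2 <-- new_leaf (drop (size xs')./2 xs') ;; ret [:: e1; e2])).

Definition node_insert (f : nat) (es : seq entry) : timed (seq entry) :=
  if size es <= f then (e <-- new_node es ;; ret [:: e])
  else (e1 <-- new_node (take (size es)./2 es) ;;
        e2 <-- new_node (drop (size es)./2 es) ;; ret [:: e1; e2]).

Fixpoint tree_insert (f cap : nat) (t : tree) (i : nat) {struct t}
    : timed (seq entry) :=
  charge 1
  match t with
  | Leaf _ xs => leaf_insert cap xs i
  | Node es =>
      (es1 <--
         (fix go (es : seq entry) (i : nat) : timed (seq entry) :=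
            match es with
            | [::] => ret [::]
            | (n, s, c) :: es' =>
                charge 1
                  (if i <= n
                   then (r <-- tree_insert f cap c i ;;
                         charge (size es') (ret (r ++ es')))
                   else (es1 <-- go es' (i - n) ;; ret ((n, s, c) :: es1)))
            end) es i ;;
       node_insert f es1)
  end.

(* The leaf capacity is floor(log2 m) for the new length m (1 while m < 2). *)
Definition spsi_insert (f : nat) (D : spsi) (i : nat) : timed spsi :=
  let: (m, s, t) := D in
  let cap := maxn 1 (trunc_log 2 m.+1) in
  charge cap
    (r <-- tree_insert f cap t i.-1 ;;
     match r with
     | [:: e] => ret e
     | _ => new_node r
     end).

(* The sequence is s_1, ..., s_m, so s_i is nth 0 s i.-1.  Inserting at i puts a
   0 between s_(i-1) and s_i; i = 0 and i = 1 both mean the front. *)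
Definition seq_update (s : seq nat) (i : nat) (d : int) : seq nat :=
  set_nth 0 s i.-1 (addz (nth 0 s i.-1) d).

Definition can_update (s : seq nat) (i : nat) (d : int) : Prop :=
  1 <= i <= size s /\ (0 <= (nth 0 s i.-1)%:Z + d)%R.

Definition seq_insert (s : seq nat) (i : nat) : seq nat :=
  take i.-1 s ++ 0 :: drop i.-1 s.

Definition is_search (s : seq nat) (x i : nat) : Prop :=
  1 <= i <= size s /\ x < sumn (take i s) /\
  forall j, j < i -> sumn (take j s) <= x.

(* The states of the structure.  The occupancy condition is required of the
   state one starts from, and splits use the current m; a leaf untouched by
   later insertions keeps its size while log m grows. *)
Inductive spsi_state (f : nat) : spsi -> Prop :=
| state_empty : spsi_state f spsi_empty
| state_wf D : spsi_wf f D -> spsi_state f D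
| state_update D i d :
    spsi_state f D -> can_update (contents D) i d ->
    spsi_state f (value (spsi_update D i d))
| state_insert D i :
    spsi_state f D -> i <= (size (contents D)).+1 ->
    spsi_state f (value (spsi_insert f D i)).

(* Main.v *)
(* Every traversal follows one root-to-leaf path.  Internal nodes have at least
   two children, so the height is at most log m; a node costs O(f) and a leaf,
   which never holds more than about log m integers, costs O(log m).

   For the space bound, a leaf holding fewer than k/2 integers can only have been
   created while m < 2^k, so at any time there are at most 2^k such leaves.  With
   k = (log m)/2 this gives O(m / log m) leaves, hence O(m / log m) nodes, and
   all headers, counters, pointers and rounding to words cost O(m log M / log m)
   bits.  If leaf j holds l_j integers of sum S_j, the packed integers take at
   most the sum of l_j (log (1 + S_j) + 1) bits.  By concavity of log, l_j <= log m
   and the sum of the 1 + S_j being at most M, this is at most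
   m (log (M / m) + log log m + 1). *)
Require Import Defs.
From mathcomp Require Import all_boot all_order all_algebra.
From mathcomp Require Import reals exp.
From mathcomp Require Import zify ring lra.

Set Implicit Arguments.
Unset Strict Implicit.
Unset Printing Implicit Defensive.

Import Order.TTheory GRing.Theory Num.Theory.

(** * Shape of the tree: contents, leaf sizes and height *)

Definition leaf_sizes (t : tree) : seq nat := map size (leaves t).

Definition entry_ok (f lo h : nat) (e : entry) : bool :=
  [&& e.1.1 == size (flat e.2), e.1.2 == sumn (flat e.2) & btree f lo h e.2].

Lemma btree_node f lo h es :
  btree f lo h.+1 (Node es) =
  (lo <= size es <= f) && all (entry_ok f (uphalf f) h) es.
Proof. by []. Qed.

Lemma flat_node es : flat (Node es) = flatten [seq flat e.2 | e <- es].
Proof. by []. Qed.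

Lemma leaf_sizes_node es :
  leaf_sizes (Node es) = flatten [seq leaf_sizes e.2 | e <- es].
Proof. by rewrite /leaf_sizes /= map_flatten -map_comp. Qed.

Lemma btree_leavesK f lo h t : btree f lo h t -> flatten (leaves t) = flat t.
Proof.
elim: h t lo => [|h IH] [b xs|es] lo //=; first by rewrite cats0.
case/andP=> _; elim: es => [|[[n s] c] es IHes] //= /andP[/and3P[_ _ hc] hes].
by rewrite flatten_cat (IH _ _ hc) (IHes hes).
Qed.

Lemma sumn_leaf_sizes f lo h t : btree f lo h t ->
  sumn (leaf_sizes t) = size (flat t).
Proof. by move=> /btree_leavesK <-; rewrite size_flatten. Qed.

Lemma size_leaf_sizes t : size (leaf_sizes t) = size (leaves t).
Proof. by rewrite size_map. Qed.

(** Each level at least doubles the number of leaves: [3 <= f] gives [2 <= uphalf f], so nodes below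
    the root also branch at least twice. *)
Lemma expn_height_le_leaves f lo h t : 3 <= f -> 2 <= lo ->
  btree f lo h t -> 2 ^ h <= size (leaves t).
Proof.
move=> hf; have u2 : 2 <= uphalf f by lia.
elim: h t lo => [|h IH] [b xs|es] lo // hlo.
rewrite btree_node => /andP[/andP[les _] hes].
suff: size es * 2 ^ h <= size (leaves (Node es)).
  by apply: leq_trans; rewrite expnS leq_mul2r (leq_trans hlo les) orbT.
elim: es {les} hes => [|[[n s] c] es IHes] //= /andP[/and3P[_ _ hc] hes].
by rewrite size_cat mulSn leq_add ?IHes //; apply: IH hc.
Qed.

(** * Prefix sums *)

(** A named copy of the anonymous loop in [tree_sum], so that induction on the list of entries can
    be used. [node_search], [node_update] and [entries_insert] do the same for the other
    operations. *)
Fixpoint node_sum (es : seq entry) (i acc : nat) : timed nat :=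
  match es with
  | [::] => ret acc
  | (n, s, c) :: es' =>
      charge 1 (if i <= n then tree_sum c i acc
                else node_sum es' (i - n) (acc + s))
  end.

Lemma tree_sum_node es i acc :
  tree_sum (Node es) i acc = charge 1 (node_sum es i acc).
Proof. by []. Qed.

Lemma leaf_sumP xs i acc :
  value (leaf_sum xs i acc) = acc + sumn (take i xs) /\
  time (leaf_sum xs i acc) <= (size xs).+1.
Proof.
elim: xs i acc => [|x xs IH] [|i] acc //=; rewrite ?addn0 //.
by have [-> ?] := IH i (acc + x); rewrite addnA; split=> //; lia.
Qed.

Lemma tree_sumP f lo h t c i acc :
  btree f lo h t -> all (geq c) (leaf_sizes t) -> i <= size (flat t) ->
  value (tree_sum t i acc) = acc + sumn (take i (flat t)) /\
  time (tree_sum t i acc) <= f.+1 * h + c + 2.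
Proof.
elim: h t lo i acc => [|h IH] [b xs|es] lo i acc //.
  rewrite /= andbT => _ cs _; have [-> ?] := leaf_sumP xs i acc.
  by split=> //; lia.
rewrite btree_node leaf_sizes_node tree_sum_node flat_node
  => /andP[/andP[_ esf] hes] cs hi.
(* Each child scanned costs one step and at most one is entered; with the charge for the node
   itself, a level costs at most [f.+1]. *)
suff [hv ht] : value (node_sum es i acc)
    = acc + sumn (take i (flatten [seq flat e.2 | e <- es])) /\
    time (node_sum es i acc) <= size es + (f.+1 * h + c + 2).
  by split=> /=; [exact: hv | lia].
elim: es i acc {esf} hes cs hi => [|[[n s] t] es IHes] i acc /=.
  by rewrite addn0.
case/andP=> /and3P[/= /eqP en /eqP es' hc] hes; rewrite all_cat => /andP[ct cs].
rewrite size_cat take_cat -en => hi.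
case: (leqP i n) => hin /=.
  have [|-> ht] := IH t _ i acc hc ct; first by rewrite -en.
  split; last by lia.
  (* For [i = n] the traversal enters this child, while [take_cat] falls into its second case;
     nothing is taken from the later children, so both agree. *)
  case: ltnP => // hni; have -> : i = n by lia.
  by rewrite subnn take0 cats0 en take_size.
have [|-> ht] := IHes (i - n) (acc + s) hes cs; first by lia.
split; last by lia.
by rewrite ltnNge (ltnW hin) /= sumn_cat es' addnA.
Qed.

(** * Search *)

Fixpoint node_search (es : seq entry) (x j : nat) : timed nat :=
  match es with
  | [::] => ret j
  | (n, s, c) :: es' =>
      charge 1 (if x < s then tree_search c x j
                else node_search es' (x - s) (j + n))
  end.

Lemma tree_search_node es x j :
  tree_search (Node es) x j = charge 1 (node_search es x j).
Proof. by []. Qed.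

Lemma is_search_catl s1 s2 x i :
  is_search s1 x i -> is_search (s1 ++ s2) x i.
Proof.
move=> [hi [hx hj]]; split; first by rewrite size_cat; lia.
have tk k : k <= i -> take k (s1 ++ s2) = take k s1.
  by move=> hk; rewrite takel_cat //; lia.
by split=> [|j lji]; rewrite tk ?(ltnW lji) // hj.
Qed.

(** Entries are non-negative, so no prefix of [s1] sums to more than [sumn s1 <= x] and the search
    cannot stop inside [s1]. *)
Lemma is_search_catr s1 s2 x i :
  sumn s1 <= x -> is_search s2 (x - sumn s1) i ->
  is_search (s1 ++ s2) x (size s1 + i).
Proof.
move=> hx1 [hi [hx hj]]; split; first by rewrite size_cat; lia.
split=> [|j lji]; rewrite take_cat.
  by rewrite [_ + i < _]ltnNge leq_addr /= addKn sumn_cat; lia.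
case: ltnP => hjs.
  by apply: leq_trans hx1; rewrite -{2}(cat_take_drop j s1) sumn_cat leq_addr.
by have := hj (j - size s1); rewrite sumn_cat; lia.
Qed.

Lemma leaf_searchP xs x j : x < sumn xs ->
  (exists2 i, value (leaf_search xs x j) = j + i & is_search xs x i) /\
  time (leaf_search xs x j) <= size xs.
Proof.
elim: xs x j => [|y xs IH] x j //= hx.
case: ltnP => hxy /=.
  split; last by [].
  exists 1; first by rewrite /= addn1.
  by split=> //=; rewrite take0 /=; split=> [|[|k]] //; lia.
have [|[i ei hi] ht] := IH (x - y) j.+1; first by lia.
split; last by rewrite /=; lia.
exists i.+1; first by rewrite /= ei; lia.
by apply: (@is_search_catr [:: y]) => /=; rewrite addn0.
Qed.

Lemma tree_searchP f lo h t c x j :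
  btree f lo h t -> all (geq c) (leaf_sizes t) -> x < sumn (flat t) ->
  (exists2 i, value (tree_search t x j) = j + i & is_search (flat t) x i) /\
  time (tree_search t x j) <= f.+1 * h + c + 2.
Proof.
elim: h t lo x j => [|h IH] [b xs|es] lo x j //.
  rewrite /= andbT => _ cs /leaf_searchP - /(_ j)[ex ht].
  by split=> //; lia.
rewrite btree_node leaf_sizes_node tree_search_node flat_node
  => /andP[/andP[_ esf] hes] cs hx.
suff [ex ht] : (exists2 i, value (node_search es x j) = j + i
      & is_search (flatten [seq flat e.2 | e <- es]) x i) /\
    time (node_search es x j) <= size es + (f.+1 * h + c + 2).
  by split=> /=; [exact: ex | lia].
elim: es x j {esf} hes cs hx => [|[[n s] t] es IHes] x j //=.
case/andP=> /and3P[/= /eqP en /eqP es' hc] hes; rewrite all_cat => /andP[ct cs].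
rewrite sumn_cat -es' => hx.
case: ltnP => hxs /=.
  have [|[i ei hi] ht] := IH t _ x j hc ct; first by rewrite -es'.
  split; last by lia.
  by exists i => //; apply: is_search_catl.
have [|[i ei hi] ht] := IHes (x - s) (j + n) hes cs; first by lia.
split; last by rewrite /=; lia.
exists (n + i); first by rewrite /= ei addnA.
by rewrite en; apply: is_search_catr; rewrite -es'.
Qed.

(** * Update *)

Fixpoint node_update (es : seq entry) (i : nat) (d : int)
    : timed (seq entry) :=
  match es with
  | [::] => ret [::]
  | (n, s, c) :: es' =>
      charge 1
        (if i < n
         then (c1 <-- tree_update c i d ;; ret ((n, addz s d, c1) :: es'))
         else (es1 <-- node_update es' (i - n) d ;; ret ((n, s, c) :: es1)))
  end.

Lemma tree_update_node es i d :
  tree_update (Node es) i d =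
  charge 1 (es1 <-- node_update es i d ;; ret (Node es1)).
Proof.
rewrite /=; congr (charge 1 (bind _ _)).
by elim: es i => [|[[n s] c] es IH] i //=; rewrite IH.
Qed.

Lemma set_nth_cat (s1 s2 : seq nat) i x :
  i < size s1 + size s2 ->
  set_nth 0 (s1 ++ s2) i x =
  if i < size s1 then set_nth 0 s1 i x ++ s2
  else s1 ++ set_nth 0 s2 (i - size s1) x.
Proof.
elim: s1 i => [|y s1 IH] [|i] //=; rewrite addSn ltnS => hi.
by rewrite IH // ltnS subSS; case: ifP.
Qed.

Lemma sumn_set_nth_addz (xs : seq nat) i (d : int) : i < size xs ->
  (0 <= (nth 0 xs i)%N%:Z + d)%R ->
  sumn (set_nth 0 xs i (addz (nth 0 xs i) d)) = addz (sumn xs) d.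
Proof.
rewrite /addz; elim: xs i => [|x xs IH] [|i] //= hi hd; first by lia.
(* [addz] takes an absolute value, so the total plus [d] must be non-negative too; it is, since the
   total is at least the entry changed. *)
rewrite IH //; suff : nth 0 xs i <= sumn xs by lia.
by elim: xs i hi {IH hd} => [|y xs IH] [|i] //= hi; [lia | have := IH i hi; lia].
Qed.

Lemma size_set_nth_lt (xs : seq nat) i x : i < size xs ->
  size (set_nth 0 xs i x) = size xs.
Proof. by move=> hi; rewrite size_set_nth; apply/maxn_idPr. Qed.

Lemma leaf_updateP b xs i (d : int) : i < size xs ->
  let xs' := set_nth 0 xs i (addz (nth 0 xs i) d) in
  value (leaf_update b xs i d) = Leaf (width xs') xs' /\
  time (leaf_update b xs i d) <= 2 * size xs + 2.
Proof.
move=> hi /=; rewrite /leaf_update size_set_nth_lt //.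
by case: eqP => [->|_] /=; split=> //; lia.
Qed.

(** Leaf sizes are unchanged, so an update cannot disturb leaf occupancy. The factor 2 of [c] pays
    for the scan and a possible repacking. *)
Lemma tree_updateP f lo h t c i (d : int) :
  btree f lo h t -> all (geq c) (leaf_sizes t) -> i < size (flat t) ->
  (0 <= (nth 0 (flat t) i)%N%:Z + d)%R ->
  let t' := value (tree_update t i d) in
  [/\ btree f lo h t',
      flat t' = set_nth 0 (flat t) i (addz (nth 0 (flat t) i) d),
      leaf_sizes t' = leaf_sizes t
    & time (tree_update t i d) <= f.+1 * h + 2 * c + 3].
Proof.
elim: h t lo i => [|h IH] [b xs|es] lo i //.
  move=> _ /andP[cs _] hi _; have [hv ht] := @leaf_updateP b xs i d hi.
  have {}hv : value (tree_update (Leaf b xs) i d) = _ := hv.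
  move=> t'; rewrite {}/t' {}hv.
  split=> //; first exact: eqxx.
    by rewrite /leaf_sizes /= size_set_nth_lt.
  by move: ht cs; rewrite /leaf_update /=; lia.
rewrite btree_node leaf_sizes_node tree_update_node flat_node
  => /andP[/andP[loes esf] hes] cs hi hd.
suff [hes' sz fl sh ht] : let es' := value (node_update es i d) in
    [/\ all (entry_ok f (uphalf f) h) es', size es' = size es,
        flat (Node es') = set_nth 0 (flat (Node es)) i
                            (addz (nth 0 (flat (Node es)) i) d),
        leaf_sizes (Node es') = leaf_sizes (Node es)
      & time (node_update es i d) <= size es + (f.+1 * h + 2 * c + 3)].
  move=> t'; rewrite {}/t' [value (charge _ _)]/= btree_node.
  rewrite sz loes esf hes' fl sh leaf_sizes_node.
  by split=> //=; lia.
rewrite -flat_node in hi hd.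
elim: es i {loes esf} hes cs hi hd => [|[[n s] t] es IHes] i //=.
case/andP=> /and3P[/= /eqP en /eqP es' hc] hes; rewrite all_cat => /andP[ct cs].
rewrite size_cat nth_cat -en => hi.
rewrite set_nth_cat -?en //.
case: ltnP => hin hd /=.
  have [|//|bt fl sh ht] := IH t _ i hc ct; first by rewrite -en.
  rewrite hes fl /entry_ok /= bt andbT fl size_set_nth_lt -?en //.
  rewrite sumn_set_nth_addz -?en // -es' !eqxx !leaf_sizes_node /= sh.
  by split=> //; lia.
have [|//|bt sz fl sh ht] := IHes (i - n) hes cs; first by rewrite flat_node; lia.
have -> : entry_ok f (uphalf f) h (n, s, t).
  by rewrite /entry_ok /= en es' hc !eqxx.
rewrite /= in fl; rewrite bt sz fl.
by rewrite !leaf_sizes_node /= -!leaf_sizes_node sh; split=> //; lia.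
Qed.

(** * Insertion and splitting *)

(** All that the occupancy argument needs to know of an insertion; it can then be carried out on
    lists of numbers, without trees. *)
Definition leaf_step (cap : nat) (L L' : seq nat) : Prop :=
  exists L1 n L2 new,
    [/\ L = L1 ++ n :: L2, L' = L1 ++ new ++ L2
      & n < cap /\ new = [:: n.+1] \/
        cap <= n /\ new = [:: n.+1./2; n.+1 - n.+1./2]].

Lemma leaf_step_cat cap A B L L' :
  leaf_step cap L L' -> leaf_step cap (A ++ L ++ B) (A ++ L' ++ B).
Proof.
move=> [L1 [n [L2 [new [-> -> hn]]]]].
by exists (A ++ L1), n, (L2 ++ B), new; split; rewrite -?catA.
Qed.

Lemma insert_catl (s1 s2 : seq nat) i : i <= size s1 ->
  take i (s1 ++ s2) ++ 0 :: drop i (s1 ++ s2) =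
  (take i s1 ++ 0 :: drop i s1) ++ s2.
Proof.
move=> hi; rewrite takel_cat // drop_cat -catA.
case: ltngtP hi => // -> _.
by rewrite subnn drop0 drop_size.
Qed.

Lemma insert_catr (s1 s2 : seq nat) i : size s1 <= i ->
  take i (s1 ++ s2) ++ 0 :: drop i (s1 ++ s2) =
  s1 ++ take (i - size s1) s2 ++ 0 :: drop (i - size s1) s2.
Proof. by move=> hi; rewrite take_cat drop_cat ltnNge hi /= catA. Qed.

Lemma sumn_counters f lo h es : all (entry_ok f lo h) es ->
  sumn [seq e.1.1 | e <- es] = size (flat (Node es)) /\
  sumn [seq e.1.2 | e <- es] = sumn (flat (Node es)).
Proof.
elim: es => [|[[n s] t] es IH] //= /andP[/and3P[/= /eqP -> /eqP -> _] /IH[-> ->]].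
by rewrite size_cat sumn_cat.
Qed.

Lemma new_node_ok f lo h es :
  all (entry_ok f (uphalf f) h) es -> lo <= size es <= f ->
  entry_ok f lo h.+1 (value (new_node es)).
Proof.
move=> hes sz; have [en es'] := sumn_counters hes.
by apply/and3P; split; [exact/eqP | exact/eqP | exact/andP].
Qed.

Lemma new_leaf_ok f lo xs : entry_ok f lo 0 (value (new_leaf xs)).
Proof. by rewrite /entry_ok /= !eqxx. Qed.

(** Without a split the visited root keeps its own bound [lo], which is 2 at the root of the tree;
    after a split both halves become children of a node and must meet [uphalf f]. *)
Definition insert_result f lo h (r : seq entry) : Prop :=
  (exists2 e, r = [:: e] & entry_ok f lo h e) \/
  (exists e1 e2, [/\ r = [:: e1; e2], entry_ok f (uphalf f) h e1
                   & entry_ok f (uphalf f) h e2]).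

(** [Node r] is a device to speak of the joint contents and leaf sizes of the returned entries. The
    time is that of a split: four passes over [cap.+1] integers and two allocations. *)
Lemma leaf_insertP f lo cap xs i : size xs <= cap ->
  let r := value (leaf_insert cap xs i) in
  [/\ insert_result f lo 0 r,
      flat (Node r) = take i xs ++ 0 :: drop i xs,
      leaf_step cap [:: size xs] (leaf_sizes (Node r))
    & time (leaf_insert cap xs i) <= 4 * cap + 6].
Proof.
move=> hs r.
have sz : size (take i xs ++ 0 :: drop i xs) = (size xs).+1.
  by rewrite size_cat /= addnS -size_cat cat_take_drop.
rewrite {}/r /leaf_insert; move: (_ ++ _) sz => ys sz; rewrite sz.
case: (leqP (size xs).+1 cap) => hc.
  split; rewrite /leaf_sizes /=; try by rewrite ?cats0 //; lia.
    by left; eexists; [reflexivity | exact: new_leaf_ok].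
  exists [::], (size xs), [::], [:: (size xs).+1]; rewrite /= sz.
  by split=> //; left.
split; rewrite /leaf_sizes.
- right; do 2!eexists; split; [reflexivity | exact: new_leaf_ok..].
- by rewrite /= cats0 cat_take_drop.
- exists [::], (size xs), [::], [:: (size xs).+1./2; (size xs).+1 - (size xs).+1./2].
  rewrite /= size_drop size_take sz; split=> //; last by right.
  by case: ifP => //; lia.
- by rewrite /= size_drop size_take sz; case: ifP; lia.
Qed.

Lemma node_insertP f lo h es :
  2 < f -> lo <= uphalf f -> all (entry_ok f (uphalf f) h) es ->
  lo <= size es <= f.+1 ->
  let r := value (node_insert f es) in
  [/\ insert_result f lo h.+1 r, flat (Node r) = flat (Node es),
      leaf_sizes (Node r) = leaf_sizes (Node es)
    & time (node_insert f es) <= f + 3].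
Proof.
move=> hf hlo hes /andP[h1 h2] r; rewrite {}/r /node_insert.
case: (leqP (size es) f) => hc.
  split; rewrite ?leaf_sizes_node; try by rewrite /= ?cats0 //; lia.
  - by left; eexists; [reflexivity | apply: new_node_ok; rewrite // h1].
  - by rewrite [map _ (value _)]/= [flatten _]/= cats0 leaf_sizes_node.
have sz : size es = f.+1 by lia.
move: hes; rewrite -{1}(cat_take_drop (size es)./2 es) all_cat => /andP[ha hb].
(* Half of [f.+1], rounded down, is [uphalf f]: the first part has exactly the minimum number of
   children, and the second at least as many. *)
have sa : size (take (size es)./2 es) = uphalf f.
  by rewrite size_take sz; case: ifP; lia.
have sb : size (drop (size es)./2 es) = f.+1 - uphalf f.
  by rewrite size_drop sz; lia.
split.
- right; do 2!eexists; split; first reflexivity.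
    by apply: new_node_ok; rewrite // sa; lia.
  by apply: new_node_ok; rewrite // sb; lia.
- by rewrite /= cats0 -flatten_cat -map_cat cat_take_drop.
- rewrite [value _]/= !leaf_sizes_node /= !leaf_sizes_node cats0.
  by rewrite -flatten_cat -map_cat cat_take_drop.
- by rewrite /= sa sb; lia.
Qed.

Fixpoint entries_insert f cap (es : seq entry) (i : nat)
    : timed (seq entry) :=
  match es with
  | [::] => ret [::]
  | (n, s, c) :: es' =>
      charge 1
        (if i <= n
         then (r <-- tree_insert f cap c i ;;
               charge (size es') (ret (r ++ es')))
         else (es1 <-- entries_insert f cap es' (i - n) ;;
               ret ((n, s, c) :: es1)))
  end.

Lemma tree_insert_node f cap es i :
  tree_insert f cap (Node es) i =
  charge 1 (es1 <-- entries_insert f cap es i ;; node_insert f es1).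
Proof.
rewrite [LHS]/=; congr (charge 1 (bind _ _)).
by elim: es i => [|[[n s] c] es IH] i //=; rewrite IH.
Qed.

(** The [2 * f + 4] per level is one for the node, at most [f] for scanning and shifting its
    children, and [f + 3] for rebuilding or splitting it. *)
Lemma tree_insertP f lo h t cap i :
  2 < f -> 0 < lo <= uphalf f -> btree f lo h t ->
  all (geq cap) (leaf_sizes t) -> i <= size (flat t) ->
  let r := value (tree_insert f cap t i) in
  [/\ insert_result f lo h r,
      flat (Node r) = take i (flat t) ++ 0 :: drop i (flat t),
      leaf_step cap (leaf_sizes t) (leaf_sizes (Node r))
    & time (tree_insert f cap t i) <= (2 * f + 4) * h + 4 * cap + 7].
Proof.
move=> hf; elim: h t lo i => [|h IH] [b xs|es] lo i //.
  move=> _ _ /andP[cs _] _.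
  have [r1 r2 r3 r4] := leaf_insertP f lo i cs; split=> //.
  by rewrite [time _]/(1 + time (leaf_insert cap xs i)); lia.
move=> /andP[lo1 lou]; rewrite btree_node => /andP[/andP[loes esf] hes] cs hi.
rewrite leaf_sizes_node in cs.
have es0 : 0 < size es by lia.
have [hes' /andP[sz1 sz2] fl sh ht] : let es' := value (entries_insert f cap es i) in
    [/\ all (entry_ok f (uphalf f) h) es', size es <= size es' <= (size es).+1,
        flat (Node es') = take i (flat (Node es)) ++ 0 :: drop i (flat (Node es)),
        leaf_step cap (leaf_sizes (Node es)) (leaf_sizes (Node es'))
      & time (entries_insert f cap es i)
          <= size es + ((2 * f + 4) * h + 4 * cap + 7)].
  elim: es i {loes esf} hes cs hi es0 => [|[[n s] t] es IHes] i //=.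
  case/andP=> oke hes; rewrite all_cat => /andP[ct cs].
  have /and3P[/= /eqP en /eqP es' hc] := oke.
  rewrite size_cat -en => hi _.
  case: (leqP i n) => hin.
    (* With [lo := uphalf f], both cases of [insert_result] yield valid children of a node. *)
    have u2 : 0 < uphalf f <= uphalf f by lia.
    have [|rr fl sh ht] := IH t _ i u2 hc ct; first by rewrite -en.
    rewrite insert_catl -?en //=; split.
    + rewrite all_cat hes andbT.
      by case: rr => [[e -> /= ->]|[e1 [e2 [-> /= -> ->]]]].
    + rewrite size_cat; case: rr => [[e -> _]|[e1 [e2 [-> _ _]]]] /=;
        by have : @size entry es = size es by []; lia.
    + by rewrite map_cat flatten_cat; congr (_ ++ _); exact: fl.
    + rewrite leaf_sizes_node /= leaf_sizes_node map_cat flatten_cat.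
      have := @leaf_step_cat _ [::] (flatten [seq leaf_sizes e.2 | e <- es]) _ _ sh.
      by rewrite leaf_sizes_node.
    + by have : @size entry es = size es by []; lia.
  have hin' := ltnW hin; rewrite insert_catr -?en //.
  have es0 : 0 < size es by case: (es) hi => //=; lia.
  have hi' : i - n <= size (flat (Node es)) by rewrite flat_node; lia.
  have [bt sz fl sh ht] := IHes (i - n) hes cs hi' es0.
  rewrite /= in fl; rewrite /= oke bt fl; split=> //; try by lia.
  rewrite leaf_sizes_node /= -leaf_sizes_node.
  rewrite [in X in leaf_step _ _ X]leaf_sizes_node /= -leaf_sizes_node.
  by have := @leaf_step_cat _ (leaf_sizes t) [::] _ _ sh; rewrite !cats0.
have [|r1 r2 r3 r4] := @node_insertP f lo h _ hf lou hes'; first by lia.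
have er : value (tree_insert f cap (Node es) i)
    = value (node_insert f (value (entries_insert f cap es i))).
  by rewrite tree_insert_node.
move=> r; rewrite {}/r {}er r2 r3 fl; split=> //.
by rewrite tree_insert_node /=; lia.
Qed.

(** * Leaf occupancy under insertions *)

(** The last clause replaces the lower bound on leaf sizes, which is lost as [log m] grows; stated
    for every [k], it needs no record of when a leaf was created. [[:: 0]] is the empty
    structure. *)
Definition leaf_inv (m : nat) (L : seq nat) : Prop :=
  [/\ all (geq (maxn 1 (trunc_log 2 m))) L, L = [:: 0] \/ all (leq 1) L
    & forall k, count (fun n => 2 * n < k) L <= 2 ^ k].

Lemma size_le_sumn L : all (leq 1) L -> size L <= sumn L.
Proof. by elim: L => //= n L IH /andP[? /IH]; lia. Qed.

Lemma leaf_inv_step m L L' : sumn L = m -> leaf_inv m L ->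
  leaf_step (maxn 1 (trunc_log 2 m.+1)) L L' -> leaf_inv m.+1 L'.
Proof.
move=> sL [i1 i2 i3]; set cap := maxn _ _ => -[L1 [n [L2 [new [eL eL' hn]]]]].
have lecap : maxn 1 (trunc_log 2 m) <= cap.
  by have := leq_trunc_log 2 (leqnSn m); rewrite /cap; lia.
have cap1 : 0 < cap by rewrite /cap; lia.
have /and3P[c1 ncap c2] : [&& all (geq cap) L1, n <= cap & all (geq cap) L2].
  have : all (geq cap) L by apply: sub_all i1 => x /=; lia.
  by rewrite eL all_cat.
have new1 : all (leq 1) new by case: hn => [[_ ->]|[? ->]] //=; lia.
have newc : all (geq cap) new by case: hn => [[? ->]|[? ->]] /=; lia.
have sL' : sumn L' = m.+1.
  rewrite -sL eL eL' !sumn_cat /=.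
  by case: hn => [[_ ->]|[_ ->]] /=; lia.
have pos : all (leq 1) L'.
  rewrite eL' !all_cat new1 /=.
  case: i2; rewrite eL; last by rewrite all_cat /= => /and3P[-> _ ->].
  case: (L1) => [|a [|? ?]] //=; first by case: (L2).
split; [by rewrite eL' !all_cat c1 newc c2 | by right |] => k.
(* For these [k] no new small leaf appears: twice either half of a split is at least
   [n >= cap >= k]. For larger [k], [2 ^ k] exceeds the number of integers, hence of leaves. *)
case: (leqP k (trunc_log 2 m.+1)) => hk.
  apply: leq_trans (i3 k); rewrite eL eL' !count_cat leq_add2l /= leq_add2r.
  by case: hn => [[_ ->]|[? ->]] /=; rewrite /cap in lecap *; lia.
apply: leq_trans (count_size _ _) _; apply: leq_trans (size_le_sumn pos) _.
rewrite sL'; apply: ltnW; apply: leq_trans (trunc_log_ltn m.+1 (isT : 1 < 2)) _.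
by rewrite leq_exp2l.
Qed.

(** The 9 is 3 + 6: with [k = T./2] and [T <= 3 * k], the at most [2 ^ k] small leaves contribute
    [3 * 2 ^ k * 2 ^ k <= 3 * m], and the at most [2 * m / k] others [6 * m]. *)
Lemma leaf_inv_size m L : 2 <= m -> sumn L = m -> leaf_inv m L ->
  size L * trunc_log 2 m <= 9 * m.
Proof.
move=> m2 sL [_ i2 i3]; set T := trunc_log 2 m; set k := T./2.
have pos : all (leq 1) L by case: i2 => // eL; move: sL; rewrite eL /=; lia.
have szm := size_le_sumn pos.
(* If [k = 0] then [T <= 1], and the bound of [m] on the number of leaves suffices. *)
case: (posnP k) => [k0|k1].
  have T1 : T <= 1 by rewrite /k in k0; lia.
  by apply: (@leq_trans (m * 1)); [apply: leq_mul; lia | lia].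
have -> : size L = count (fun n => 2 * n < k) L + count (predC (fun n => 2 * n < k)) L.
  by rewrite count_predC.
set A := count _ L; set B := count _ L.
have hA : A <= 2 ^ k by apply: i3.
have hB : B * k <= 2 * m.
  rewrite -sL /B; elim: (L) => //= n l IH.
  by case: (ltnP (2 * n) k) => /= ?; lia.
have hT : 2 ^ k * 2 ^ k <= m.
  rewrite -expnD; apply: leq_trans (trunc_logP (isT : 1 < 2) _); last by lia.
  by rewrite leq_exp2l // /k; lia.
have kT : T <= 3 * k by rewrite /k in k1 *; lia.
have k2 : k <= 2 ^ k by apply: ltnW; apply: ltn_expl.
rewrite mulnDl.
have : A * T <= 2 ^ k * (3 * 2 ^ k) by apply: leq_mul; lia.
have : B * T <= B * (3 * k) by apply: leq_mul; lia.
by lia.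
Qed.

(** * Invariant of the whole structure and cost of its operations *)

Definition spsi_inv (f h : nat) (D : spsi) : Prop :=
  entry_ok f 2 h D /\ leaf_inv (size (contents D)) (leaf_sizes D.2).

Lemma entry_ok_btree f lo h e : entry_ok f lo h e -> btree f lo h e.2.
Proof. by case/and3P. Qed.

Lemma spsi_inv_empty f : spsi_inv f 0 spsi_empty.
Proof.
split; first by apply/and3P; split=> //; exact: eqxx.
split=> //; first by left.
by move=> k /=; case: ltnP => //= _; rewrite expn_gt0.
Qed.

Lemma spsi_inv_wf f D : spsi_wf f D -> exists h, spsi_inv f h D.
Proof.
case: D => [[m s] t] [m2 [em es] [h bt] lv]; rewrite /contents /= in m2 em es lv.
have T1 : 0 < trunc_log 2 (size (flat t)).
  by apply: trunc_log_max.
exists h; split; first by rewrite /entry_ok /= em es bt !eqxx.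
have pos : all (leq 1) (leaf_sizes t).
  by rewrite /leaf_sizes all_map; apply: sub_all lv => xs /=; lia.
rewrite /contents /=; split; [ | by right | ].
  by rewrite /leaf_sizes all_map; apply: sub_all lv => xs /=; lia.
(* The stated occupancy excludes small leaves for [k] up to [log m]; beyond that, [2 ^ k] exceeds
   the number of all leaves. *)
move=> k; case: (leqP k (trunc_log 2 (size (flat t)))) => hk.
  rewrite (eqP (_ : count _ _ == 0)) // -leqn0 leqNgt -has_count -all_predC.
  by rewrite /leaf_sizes all_map; apply: sub_all lv => xs /=; lia.
apply: leq_trans (count_size _ _) _; apply: leq_trans (size_le_sumn pos) _.
rewrite (sumn_leaf_sizes bt); apply: ltnW.
apply: leq_trans (trunc_log_ltn _ (isT : 1 < 2)) _.
by rewrite leq_exp2l.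
Qed.

Lemma spsi_sumP f h D i : spsi_inv f h D -> i <= size (contents D) ->
  value (spsi_sum D i) = sumn (take i (contents D)) /\
  time (spsi_sum D i) <= f.+1 * h + maxn 1 (trunc_log 2 (size (contents D))) + 2.
Proof. by move=> [/entry_ok_btree bt [cs _ _]] hi; apply: (tree_sumP 0 bt cs hi). Qed.

Lemma spsi_searchP f h D x : spsi_inv f h D -> x < sumn (contents D) ->
  is_search (contents D) x (value (spsi_search D x)) /\
  time (spsi_search D x)
    <= f.+1 * h + maxn 1 (trunc_log 2 (size (contents D))) + 2.
Proof.
move=> [/entry_ok_btree bt [cs _ _]] hx.
by have [[i ei hi] ht] := tree_searchP 0 bt cs hx; split; rewrite // /spsi_search ei.
Qed.

Lemma spsi_updateP f h D i d : spsi_inv f h D -> can_update (contents D) i d ->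
  [/\ spsi_inv f h (value (spsi_update D i d)),
      contents (value (spsi_update D i d)) = seq_update (contents D) i d
    & time (spsi_update D i d)
        <= f.+1 * h + 2 * maxn 1 (trunc_log 2 (size (contents D))) + 4].
Proof.
case: D => [[m s] t] [ok [cs l2 l3]] [hi hd].
have /and3P[/= /eqP em /eqP es bt] := ok; rewrite /contents /= in cs l2 l3 hi hd *.
have hi' : i.-1 < size (flat t) by lia.
have [bt' fl sh ht] := tree_updateP bt cs hi' hd.
rewrite /spsi_inv /contents /= /entry_ok /= fl sh bt' size_set_nth_lt //.
by rewrite sumn_set_nth_addz // em es !eqxx; split=> //; lia.
Qed.

(** The height may grow because a root split adds a level; the new root has two children, the least
    allowed. Computing the capacity adds a fifth multiple of it to the four of [leaf_insertP]. *)
Lemma spsi_insertP f h D i : 2 < f -> spsi_inv f h D ->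
  i <= (size (contents D)).+1 ->
  [/\ exists h', spsi_inv f h' (value (spsi_insert f D i)),
      contents (value (spsi_insert f D i)) = seq_insert (contents D) i
    & time (spsi_insert f D i)
        <= (2 * f + 4) * h + 5 * maxn 1 (trunc_log 2 (size (contents D)).+1) + 10].
Proof.
move=> hf; case: D => [[m s] t] [ok linv] hi.
have /and3P[/= /eqP em /eqP es bt] := ok; rewrite /contents /= in linv hi *.
have hi' : i.-1 <= size (flat t) by lia.
rewrite em /seq_insert; set cap := maxn _ _.
have cs : all (geq cap) (leaf_sizes t).
  case: linv => [cs _ _]; apply: sub_all cs => x /=.
  by have := leq_trunc_log 2 (leqnSn (size (flat t))); rewrite /cap; lia.
have u2 : 0 < 2 <= uphalf f by lia.
have [rr fl sh ht] := tree_insertP hf u2 bt cs hi'.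
have linv' := leaf_inv_step (sumn_leaf_sizes bt) linv sh.
have sz : size (flat (Node (value (tree_insert f cap t i.-1)))) = (size (flat t)).+1.
  by rewrite fl size_cat /= addnS -size_cat cat_take_drop.
rewrite -{}sz in linv'.
rewrite /bind; move: rr fl linv' ht; case: (tree_insert _ _ _ _) => r tm /=.
case=> [[e -> oke]|[e1 [e2 [-> ok1 ok2]]]] /=.
  rewrite leaf_sizes_node /= !cats0 => fl linv' ht; split=> //; last by lia.
  by exists h.
move=> fl linv' ht; split=> //; last by lia.
exists h.+1; split; last exact: linv'.
have := @new_node_ok f 2 h [:: e1; e2]; rewrite /= ok1 ok2; apply=> //.
by lia.
Qed.

Lemma spsi_state_inv f D : 2 < f -> spsi_state f D -> exists h, spsi_inv f h D.
Proof.
move=> hf; elim=> {D} [|D /spsi_inv_wf //|D i d _ [h inv] hu|D i _ [h inv] hi].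
- by exists 0; apply: spsi_inv_empty.
- by exists h; case: (spsi_updateP inv hu).
- by case: (spsi_insertP hf inv hi).
Qed.

(** Starting from the empty structure and the end of [s], each element is inserted as 0 at the front
    and then updated to its value. *)
Lemma spsi_state_exists f s : 2 < f ->
  exists2 D, spsi_state f D & contents D = s.
Proof.
move=> hf; elim: s => [|x s [D sD cD]]; first by exists spsi_empty => //; constructor.
have [h inv] := spsi_state_inv hf sD.
have [[h' inv'] c1 _] := @spsi_insertP f h D 0 hf inv isT.
set D1 := value (spsi_insert f D 0) in inv' c1.
have sD1 : spsi_state f D1 by apply: state_insert.
rewrite /seq_insert /= take0 drop0 cD /= in c1.
have hu : can_update (contents D1) 1 x%:Z by rewrite c1.
have [_ c2 _] := spsi_updateP inv' hu.
exists (value (spsi_update D1 1 x%:Z)); first exact: state_update.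
by rewrite c2 c1 /seq_update /addz /=; congr (_ :: _); lia.
Qed.

(** The height bound follows from [2 ^ h] being at most the number of leaves, which is at most [m]
    because no leaf is empty once [2 <= m]. *)
Lemma spsi_inv_leaves_height f h D : 2 < f -> 2 <= size (contents D) ->
  spsi_inv f h D ->
  size (leaves D.2) * trunc_log 2 (size (contents D)) <= 9 * size (contents D)
  /\ h <= trunc_log 2 (size (contents D)).
Proof.
move=> hf m2 [/entry_ok_btree bt linv]; have sL := sumn_leaf_sizes bt.
rewrite -size_leaf_sizes; split; first exact: leaf_inv_size m2 sL linv.
apply: trunc_log_max => //; apply: leq_trans (expn_height_le_leaves hf _ bt) _ => //.
case: linv => _ [eL|pos] _; last by rewrite -size_leaf_sizes -sL size_le_sumn.
by move: m2; rewrite /contents -sL eL.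
Qed.

(** * Bit count in terms of leaves and field widths *)

Lemma array_bits_le w n : array_bits w n <= n + w.
Proof.
rewrite /array_bits mulnC; apply: leq_trans (leq_trunc_div _ _) _.
by lia.
Qed.

(* The summand on the left counts one more internal node: there are at least as
   many leaves as internal nodes plus one, since every node has two children. *)
Lemma tree_bits_le f lo h t w : 2 < f -> 2 <= lo -> btree f lo h t ->
  tree_bits f w t + (3 * f + 1) * w <=
  (3 * f + 5) * w * size (leaves t)
  + sumn [seq size xs * width xs | xs <- leaves t].
Proof.
move=> hf; have u2 : 2 <= uphalf f by lia.
elim: h t lo => [|h IH] [b xs|es] lo // hlo.
  (* Three header words, one word of rounding and the [3 * f + 1] words of the extra summand make
     [3 * f + 5]. *)
  by move=> /eqP -> /=; have := array_bits_le w (size xs * width xs); lia.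
rewrite btree_node => /andP[/andP[les _] hes].
suff : sumn [seq tree_bits f w e.2 | e <- es] + size es * ((3 * f + 1) * w) <=
    (3 * f + 5) * w * size (leaves (Node es))
    + sumn [seq size xs * width xs | xs <- leaves (Node es)].
  have : 2 * ((3 * f + 1) * w) <= size es * ((3 * f + 1) * w).
    by rewrite leq_mul2r (leq_trans hlo les) orbT.
  by move=> /=; lia.
elim: es {les} hes => [|[[n s] c] es IHes] //= /andP[/and3P[_ _ hc] hes].
have := IHes hes; have := IH _ _ u2 hc; rewrite /= size_cat map_cat sumn_cat mulnDr.
by lia.
Qed.

Local Open Scope ring_scope.

(** * Base-2 logarithm and its concavity *)

Section Log2.
Variable R : realType.

Lemma ln2_gt0 : 0 < ln 2 :> R.
Proof. by apply: ln_gt0; lra. Qed.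

Lemma log2_le (x y : R) : 0 < x -> x <= y -> log2 x <= log2 y.
Proof.
move=> x0 xy; rewrite /log2 ler_pM2r ?invr_gt0 ?ln2_gt0 // ler_ln ?posrE //.
exact: lt_le_trans xy.
Qed.

Lemma log2_ge0 (x : R) : 1 <= x -> 0 <= log2 x.
Proof. by move=> x1; apply: divr_ge0; [exact: ln_ge0 | exact: ltW ln2_gt0]. Qed.

Lemma log2_expn k : log2 ((2 ^ k)%N%:R : R) = k%:R.
Proof.
rewrite /log2 natrX lnXn; last by lra.
by rewrite -[ln _ *+ k]mulr_natl mulfK // gt_eqF // ln2_gt0.
Qed.

Lemma log2M (x y : R) : 0 < x -> 0 < y -> log2 (x * y) = log2 x + log2 y.
Proof. by move=> x0 y0; rewrite /log2 lnM ?posrE // mulrDl. Qed.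

Lemma trunc_log_le_log2 (n : nat) : (0 < n)%N -> (trunc_log 2 n)%:R <= log2 (n%:R : R).
Proof.
move=> n0; rewrite -(log2_expn (trunc_log 2 n)); apply: log2_le.
  by rewrite ltr0n expn_gt0.
by rewrite ler_nat trunc_logP.
Qed.

Lemma log2_le_trunc_log (n : nat) : (0 < n)%N ->
  log2 (n%:R : R) <= (trunc_log 2 n).+1%:R.
Proof.
move=> n0; rewrite -(log2_expn (trunc_log 2 n).+1); apply: log2_le; first by rewrite ltr0n.
by rewrite ler_nat ltnW // trunc_log_ltn.
Qed.

(** The maximum is at most the sum; the [1 +] keeps the argument of the logarithm positive for an
    all-zero leaf. *)
Lemma width_le_log2 xs : (width xs)%:R <= log2 ((1 + sumn xs)%:R : R) + 1.
Proof.
rewrite /width -natr1 lerD2r.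
set n := \max_(x <- xs) x.
have nS : (n <= sumn xs)%N.
  rewrite /n; elim: (xs) => [|x l IH]; first by rewrite big_nil.
  by rewrite big_cons /=; lia.
apply: (le_trans (y := (trunc_log 2 (1 + sumn xs))%:R)).
  by rewrite ler_nat leq_trunc_log //; lia.
exact: trunc_log_le_log2.
Qed.

(** Concavity: the graph lies below its tangent at [A], by [ln (1 + y) <= y] at [y = x / A - 1]. *)
Lemma log2_tangent (x A : R) : 0 < x -> 0 < A ->
  log2 x <= log2 A + (x / A - 1) / ln 2.
Proof.
move=> x0 A0; rewrite /log2 -mulrDl ler_pM2r ?invr_gt0 ?ln2_gt0 //.
rewrite -lerBlDl -ln_div ?posrE //.
have xA : 0 < x / A by rewrite divr_gt0.
by have := @le_ln1Dx R (x / A - 1); rewrite [1 + _]addrC subrK; apply; lra.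
Qed.

(** Using one tangent point [A] for all leaves makes the bound linear in the leaf sums, so it adds
    up by induction in place of Jensen's inequality. Only in the slope term is the leaf size
    replaced by [T]. *)
Lemma sum_width_le_tangent (L : seq (seq nat)) (T : nat) (A : R) : 0 < A ->
  all (geq T) (map size L) ->
  (sumn [seq (size xs * width xs)%N | xs <- L])%:R <=
  (size (flatten L))%:R * (log2 A + 1)
  + (T%:R * (size L + sumn (flatten L))%:R / A - (size (flatten L))%:R) / ln 2.
Proof.
move=> A0; elim: L => [|xs L IH] /=.
  by move=> _; rewrite mulr0 !mul0r subr0 mul0r addr0.
case/andP=> hT /IH {IH}; rewrite size_cat sumn_cat.
rewrite !natrD natrM.
set a := (sumn (map _ _))%:R; set m := (size _)%:R; set S := (sumn (flatten L))%:R.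
set l := (size xs)%:R; set N := (size L).+1%:R.
have -> : N = 1 + (size L)%:R by rewrite /N -natr1 addrC.
set N' := (size L)%:R => IH.
have s0 : 0 < (1 + sumn xs)%:R :> R by rewrite ltr0n.
have w := le_trans (width_le_log2 xs) (lerD (log2_tangent s0 A0) (lexx 1)).
have l0 : 0 <= l by [].
have {w} := ler_wpM2l l0 w.
have lT : l / A / ln 2 * (1 + sumn xs)%:R <= T%:R / A / ln 2 * (1 + sumn xs)%:R.
  rewrite ler_pM2r // ler_pM2r ?invr_gt0 ?ln2_gt0 // ler_pM2r ?invr_gt0 //.
  by rewrite ler_nat.
move: lT IH; rewrite natrD; set s := (sumn xs)%:R; set w := (width xs)%:R.
set c := (ln 2)^-1; set iA := A^-1; set lA := log2 A.
by move=> *; lra.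
Qed.

(* The tangent is taken at A = T M / m. *)
Lemma sum_width_le (L : seq (seq nat)) (T : nat) :
  let m := size (flatten L) in
  let M := (m + sumn (flatten L))%N in
  (0 < T)%N -> (0 < m)%N -> all (geq T) (map size L) -> all (leq 1) (map size L) ->
  (sumn [seq (size xs * width xs)%N | xs <- L])%:R <=
  m%:R * (log2 (M%:R / m%:R) + log2 T%:R + 1 : R).
Proof.
move=> m M T0 m0 hT h1.
have mR : 0 < m%:R :> R by rewrite ltr0n.
have MR : 0 < M%:R :> R by rewrite ltr0n /M; lia.
have TR : 0 < T%:R :> R by rewrite ltr0n.
have A0 : 0 < (M%:R / m%:R) * T%:R :> R by rewrite !mulr_gt0 ?invr_gt0.
apply: le_trans (sum_width_le_tangent A0 hT) _.
rewrite log2M ?divr_gt0 // -[leRHS]addr0 lerD // -/m.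
(* For this [A] the correction term is at most 0: it compares [T] times the number of leaves plus
   the total sum with [m * A = T * M], and there are at most [m] leaves. *)
rewrite pmulr_lle0 ?invr_gt0 ?ln2_gt0 // subr_le0 ler_pdivrMr //.
have -> : m%:R * (M%:R / m%:R * T%:R) = T%:R * M%:R :> R.
  by field; rewrite gt_eqF.
rewrite ler_pM2l // ler_nat leq_add2r.
by have := size_le_sumn h1; rewrite size_map -size_flatten.
Qed.

End Log2.

(** * The space bound *)

(** There is at least one leaf, so the three words at the top raise the constant from [3 * f + 5] to
    [3 * f + 8]. *)
Lemma spsi_bits_le f h D w : (2 < f)%N -> spsi_inv f h D ->
  (spsi_bits f w D <= (3 * f + 8) * (w * size (leaves D.2))
     + sumn [seq size xs * width xs | xs <- leaves D.2])%N.
Proof.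
move=> hf [/entry_ok_btree bt _].
have := tree_bits_le w hf (leqnn 2) bt; have := expn_height_le_leaves hf (leqnn 2) bt.
have : (0 < 2 ^ h)%N by rewrite expn_gt0.
rewrite /spsi_bits; set N := size _ => h0 hN.
have : (w * 1 <= w * N)%N by rewrite leq_mul2l (leq_trans h0 hN) orbT.
by lia.
Qed.

(** Since [log2 m <= 2 * T], [leaf_inv_size] gives a constant 18, which the leading factor 2 turns
    into 9. The [+ 1] pays for the extra bit per integer, as [log2 M / log2 m >= 1]. The sign of
    [kappa] is not given, hence its absolute value. *)
Lemma spsi_bits_le_log2 (R : realType) (f h : nat) (kappa : R) D w :
  let m := size (contents D) in
  let M := (m + sumn (contents D))%N in
  (2 < f)%N -> (2 <= m)%N -> spsi_inv f h D ->
  w%:R <= kappa * log2 (M%:R : R) ->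
  (spsi_bits f w D)%:R <=
  2 * m%:R * (log2 (M%:R / m%:R) + log2 (log2 (m%:R : R))
              + (9 * (3 * f + 8)%:R * `|kappa| + 1) * (log2 M%:R / log2 m%:R)).
Proof.
move=> m M hf m2 inv hw.
have [NT _] := spsi_inv_leaves_height hf m2 inv.
have [/entry_ok_btree bt linv] := inv.
have fl : flatten (leaves D.2) = contents D := btree_leavesK bt.
set N := size (leaves D.2) in NT *; set T := trunc_log 2 m in NT *.
have T1 : (0 < T)%N by apply: trunc_log_max.
have hT : all (geq T) (map size (leaves D.2)).
  by case: linv; rewrite -/m -/T => cs _ _; apply: sub_all cs => x /=; lia.
have h1 : all (leq 1) (map size (leaves D.2)).
  case: linv => _ [eL|//] _; have := sumn_leaf_sizes bt.
  by rewrite eL -/(contents D) -/m /=; lia.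
have := sum_width_le R T1 _ hT h1; rewrite fl -/m -/M => /(_ (ltnW m2)).
have := spsi_bits_le w hf inv; rewrite -(ler_nat R) natrD 2!natrM -/N.
set B := (spsi_bits f w D)%:R; set S := (sumn _)%:R; set LMm := log2 (_ / _).
set LT := log2 T%:R; set Lm := log2 m%:R; set LM := log2 M%:R in hw *.
move=> hB hS.
have mR : 0 < m%:R :> R by rewrite ltr0n; lia.
have TLm : T%:R <= Lm by apply: trunc_log_le_log2; lia.
have LmT : Lm <= 2 * T%:R.
  apply: le_trans (log2_le_trunc_log R _) _; first by lia.
  by rewrite -natrM ler_nat -/T; lia.
have T1R : 1 <= T%:R :> R by rewrite ler1n.
have Lm0 : 0 < Lm by lra.
have LMm0 : 0 <= LMm.
  by apply: log2_ge0; rewrite ler_pdivlMr // mul1r ler_nat leq_addr.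
have LTLm : LT <= log2 Lm by apply: log2_le; lra.
have LT0 : 0 <= LT by apply: log2_ge0.
have LmLM : Lm <= LM by apply: log2_le; rewrite // ler_nat leq_addr.
set r := LM / Lm; have r1 : 1 <= r by rewrite ler_pdivlMr // mul1r.
have eLM : LM = r * Lm by rewrite /r divfK // gt_eqF.
have hNL : N%:R * Lm <= 18 * m%:R.
  apply: le_trans (_ : N%:R * (2 * T%:R) <= _); first by rewrite ler_wpM2l.
  by move: NT; rewrite -(ler_nat R) !natrM; lra.
have hwN : w%:R * N%:R <= 18 * (`|kappa| * (m%:R * r)).
  have h2 : w%:R <= `|kappa| * LM.
    apply: le_trans hw _; apply: ler_wpM2r; last exact: ler_norm.
    by apply: le_trans LmLM; exact: ltW.
  apply: (le_trans (ler_wpM2r (ler0n R N) h2)); rewrite eLM.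
  have kr0 : 0 <= `|kappa| * r by rewrite mulr_ge0 //; lra.
  by have := ler_wpM2l kr0 hNL; lra.
have f0 : 0 <= (3 * f + 8)%:R :> R by [].
have := ler_wpM2l f0 hwN.
have hX : m%:R * (LMm + LT + 1) <= m%:R * (2 * (LMm + log2 Lm + r)).
  by rewrite ler_pM2l //; lra.
by lra.
Qed.

(* f is the node fanout and w the width in bits of a machine word, hence of
   every pointer and counter; w is at most kappa * log M. *)
Theorem theorem1 (R : realType) (f : nat) (kappa : R) (hf : (3 <= f)%N) :
  exists C : R,
  forall s : seq nat, (2 <= size s)%N ->
  let m := size s in
  let M := (m + sumn s)%N in
  (exists D : spsi, spsi_state f D /\ contents D = s) /\
  forall D : spsi, spsi_state f D -> contents D = s ->
  [/\ (forall w : nat, (M < 2 ^ w)%N -> w%:R <= kappa * log2 (M%:R : R) ->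
         (spsi_bits f w D)%:R <=
           2 * m%:R * (log2 (M%:R / m%:R) + log2 (log2 (m%:R : R))
                       + C * (log2 M%:R / log2 m%:R))),
      (forall i : nat, (i <= m)%N ->
         value (spsi_sum D i) = sumn (take i s) /\
         (time (spsi_sum D i))%:R <= C * log2 (m%:R : R)),
      (forall x : nat, (x < sumn s)%N ->
         is_search s x (value (spsi_search D x)) /\
         (time (spsi_search D x))%:R <= C * log2 (m%:R : R)),
      (forall (i : nat) (d : int), can_update s i d ->
         contents (value (spsi_update D i d)) = seq_update s i d /\
         (time (spsi_update D i d))%:R <= C * log2 (m%:R : R))
    & (forall i : nat, (i <= m.+1)%N ->
         contents (value (spsi_insert f D i)) = seq_insert s i /\
         (time (spsi_insert f D i))%:R <= C * log2 (m%:R : R))].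
Proof.
pose C1 : R := 9 * (3 * f + 8)%:R * `|kappa| + 1.
(* [C1] serves the space and [2 * f + 24] the time: insertion costs at most
   [(2 * f + 4) * T + 5 * T.+1 + 10], and [1 <= T]. *)
exists (C1 + (2 * f + 24)%:R) => s s2 m M; split.
  by have [D sD cD] := spsi_state_exists s hf; exists D.
move=> D sD cD; have [h inv] := spsi_state_inv hf sD.
have cm : size (contents D) = m by rewrite cD.
have m0 : (0 < m)%N by apply: ltnW.
have hT : (h <= trunc_log 2 m)%N.
  by have := @spsi_inv_leaves_height f h D hf; rewrite cm => /(_ s2 inv)[].
set T := trunc_log 2 m in hT.
have T1 : (0 < T)%N by apply: trunc_log_max.
have capT : maxn 1 T = T by lia.
(* As [m.+1 <= 2 * m], one more integer raises the logarithm by at most one. *)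
have capS : (maxn 1 (trunc_log 2 m.+1) <= T.+1)%N.
  rewrite geq_max /= -(trunc_log2_double m0).
  by rewrite leq_trunc_log // -addnn; lia.
have TR : T%:R <= log2 (m%:R : R) by apply: trunc_log_le_log2.
have LM0 : 0 <= log2 (M%:R : R) by apply: log2_ge0; rewrite ler1n /M; lia.
have Lm0 : 0 <= log2 (m%:R : R) by apply: log2_ge0; rewrite ler1n.
have C10 : 0 <= C1 by rewrite addr_ge0 ?mulr_ge0.
have hh k : (k * h <= k * T)%N by rewrite leq_mul2l hT orbT.
have tm n : (n <= (2 * f + 24) * T)%N -> n%:R <= (C1 + (2 * f + 24)%:R) * log2 (m%:R : R).
  rewrite -(ler_nat R) natrM => /le_trans; apply.
  apply: (le_trans (ler_wpM2l (ler0n R _) TR)).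
  by rewrite ler_wpM2r // lerDr.
split=> [w _ hw|i hi|x hx|i d hu|i hi].
- have := @spsi_bits_le_log2 R f h kappa D w; rewrite cm cD -/M => /(_ hf s2 inv hw).
  move=> /le_trans; apply; rewrite ler_wpM2l ?mulr_ge0 // lerD2l ler_wpM2r //.
    by rewrite divr_ge0.
  by rewrite lerDl.
- have := spsi_sumP inv; rewrite cm cD => /(_ i hi)[-> ht]; split=> //.
  by apply: tm; have := hh f.+1; lia.
- have := spsi_searchP inv; rewrite cm cD => /(_ x hx)[? ht]; split=> //.
  by apply: tm; have := hh f.+1; lia.
- have := spsi_updateP inv; rewrite cm cD => /(_ i d hu)[_ -> ht]; split=> //.
  by apply: tm; have := hh f.+1; lia.
- have := spsi_insertP hf inv; rewrite cm cD => /(_ i hi)[_ -> ht]; split=> //.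
  by apply: tm; have := hh (2 * f + 4)%N; lia.
Qed.
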